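(* Let $q=-\exp(\frac{\pi i}{4})$, so that $q^2=i$ has multiplicative order $\ell=4$. For each $n=3,4,\dots$ there is a surjective algebra homomorphism $\phi_n:TL_n(q)\to\mathcal{C}_n^0$ which induces an isomorphism $\overline{\phi}_n:Q_n(4)\overset{\simeq}{\longrightarrow}\mathcal{C}_n^0$.
   Context: $TL_n(q)$ is the associative unital $\mathbb{C}$-algebra with generators $f_1,\dots,f_{n-1}$ and relations $f_i^2=-(q+q^{-1})f_i$, $f_if_{i\pm1}f_i=f_i$, $f_if_j=f_jf_i$ for $|i-j|\ge 2$; for the given $q$, $-(q+q^{-1})=\sqrt2$. $E_3\in TL_3(q)$ is the Jones-Wenzl idempotent, i.e. the unique non-zero idempotent with $f_iE_3=E_3f_i=0$ for $i=1,2$ (explicitly $E_3=1+f_1f_2+f_2f_1-\sqrt2(f_1+f_2)$). For $n\ge3$, $TL_3(q)\subseteq TL_n(q)$ via $f_i\mapsto f_i$, and $Q_n(4)=TL_n(q)/J_4$, where $J_4$ is the two-sided ideal generated by $E_3$. $\mathcal{C}_n$ is the complex Clifford algebra of an $n$-dimensional vector space with non-degenerate symmetric bilinear form, presented by generators $\gamma_1,\dots,\gamma_n$ and relations $\gamma_i\gamma_j+\gamma_j\gamma_i=\delta_{ij}$ for $1\le i,j\le n$. $\mathcal{C}_n^0$ is its even subalgebra, spanned by products of an even number of the $\gamma_i$. *)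

(* Defs.v *)
From HB Require Import structures.
From mathcomp Require Import all_boot all_order all_algebra generic_quotient.
From mathcomp Require Import ring_quotient.
From mathcomp Require Import complex ring lra.
From mathcomp.multinomials Require Import monalg.
From mathcomp Require Import boolp classical_sets reals sequences exp trigo.

Set Implicit Arguments.
Unset Strict Implicit.
Unset Printing Implicit Defensive.

Import Order.TTheory GRing.Theory Num.Theory.

Local Open Scope classical_set_scope.
Local Open Scope ring_scope.
Local Open Scope quotient_scope.

(* Quotients need not be non-trivial, whereas lalgType and algType require
   1 != 0. A quotient algebra is therefore equipped with its pzRingType and
   lmodType structures (compatible by quotAlg_scalerAl and quotAlg_scalerAr);
   a morphism out of it is an rmorphism which is also scalable. *)
Section QuotientAlgebra.
Variables (K : comNzRingType) (A : algType K).

Definition two_sided_ideal (I : set A) : Prop :=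
  [/\ I 0,
      forall x y, I x -> I y -> I (x + y),
      forall a x, I x -> I (a * x) &
      forall x a, I x -> I (x * a)].

Variable S : set A.

Definition ideal_gen : set A := smallest two_sided_ideal S.

Lemma ideal_gen_ideal : two_sided_ideal ideal_gen.
Proof.
split=> [I [[]]//|x y Ix Iy I cI|a x Ix I cI|x a Ix I cI];
  case: (cI) => -[_ ID IMl IMr] _.
- by apply: ID; [apply: Ix | apply: Iy].
- by apply: IMl; apply: Ix.
- by apply: IMr; apply: Ix.
Qed.

Definition ideal_pred : {pred A} := [pred x | `[< ideal_gen x >]].

Lemma ideal_predP x : reflect (ideal_gen x) (x \in ideal_pred).
Proof. exact: asboolP. Qed.

Lemma ideal_predMl a x : x \in ideal_pred -> a * x \in ideal_pred.
Proof.
have [_ _ IMl _] := ideal_gen_ideal.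
by move=> /ideal_predP Ix; apply/ideal_predP; apply: IMl.
Qed.

Lemma ideal_predMr x a : x \in ideal_pred -> x * a \in ideal_pred.
Proof.
have [_ _ _ IMr] := ideal_gen_ideal.
by move=> /ideal_predP Ix; apply/ideal_predP; apply: IMr.
Qed.

Fact ideal_pred_zmod_closed : zmod_closed ideal_pred.
Proof.
have [I0 ID IMl _] := ideal_gen_ideal.
split=> [|x y /ideal_predP Ix /ideal_predP Iy]; first exact/ideal_predP.
by apply/ideal_predP; apply: ID => //; rewrite -mulN1r; apply: IMl.
Qed.

HB.instance Definition _ :=
  GRing.isZmodClosed.Build A ideal_pred ideal_pred_zmod_closed.

Definition quotAlg : Type := Quotient.quot ideal_pred.

HB.instance Definition _ := Choice.on quotAlg.
HB.instance Definition _ := GRing.Zmodule.on quotAlg.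

Definition quotAlg_pi (x : A) : quotAlg := \pi_(Quotient.quot ideal_pred) x.
Definition quotAlg_repr (x : quotAlg) : A := repr (x : Quotient.quot ideal_pred).

Lemma quotAlg_reprK : cancel quotAlg_repr quotAlg_pi.
Proof. exact: reprK. Qed.

Lemma quotAlg_eqP (x y : A) :
  reflect (quotAlg_pi x = quotAlg_pi y) (x - y \in ideal_pred).
Proof. by rewrite Quotient.idealrBE; apply: eqP. Qed.

Lemma quotAlg_pi_repr (x : A) :
  quotAlg_repr (quotAlg_pi x) - x \in ideal_pred.
Proof. by apply/quotAlg_eqP; rewrite quotAlg_reprK. Qed.

Lemma quotAlgW (P : quotAlg -> Prop) :
  (forall a, P (quotAlg_pi a)) -> forall x, P x.
Proof. by move=> Ppi x; rewrite -[x]quotAlg_reprK. Qed.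

Definition quotAlg_one : quotAlg := quotAlg_pi 1.
(* locked only to keep unification from unfolding them *)
Definition quotAlg_mul : quotAlg -> quotAlg -> quotAlg :=
  locked (fun x y => quotAlg_pi (quotAlg_repr x * quotAlg_repr y)).
Definition quotAlg_scale : K -> quotAlg -> quotAlg :=
  locked (fun k x => quotAlg_pi (k *: quotAlg_repr x)).

Fact quotAlg_pi_zmod_morphism : zmod_morphism quotAlg_pi.
Proof. by move=> x y; rewrite /quotAlg_pi pi_addr pi_oppr. Qed.

HB.instance Definition _ :=
  GRing.isZmodMorphism.Build A quotAlg quotAlg_pi quotAlg_pi_zmod_morphism.

Lemma quotAlg_mulE (x y : A) :
  quotAlg_mul (quotAlg_pi x) (quotAlg_pi y) = quotAlg_pi (x * y).
Proof.
rewrite /quotAlg_mul -lock; apply/quotAlg_eqP; set x' := quotAlg_repr _; set y' := quotAlg_repr _.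
rewrite -(subrKA (x' * y)) -mulrBr -mulrBl rpredD //.
  by apply: ideal_predMl; exact: quotAlg_pi_repr.
by apply: ideal_predMr; exact: quotAlg_pi_repr.
Qed.

Lemma quotAlg_scaleE (k : K) (x : A) :
  quotAlg_scale k (quotAlg_pi x) = quotAlg_pi (k *: x).
Proof.
rewrite /quotAlg_scale -lock; apply/quotAlg_eqP; rewrite -scalerBr -[_ - _]mul1r scalerAl.
by apply: ideal_predMl; exact: quotAlg_pi_repr.
Qed.

Fact quotAlg_mulA : associative quotAlg_mul.
Proof.
elim/quotAlgW=> x; elim/quotAlgW=> y; elim/quotAlgW=> z.
by rewrite !quotAlg_mulE mulrA.
Qed.
Fact quotAlg_mul1l : left_id quotAlg_one quotAlg_mul.
Proof. by elim/quotAlgW=> x; rewrite quotAlg_mulE mul1r. Qed.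
Fact quotAlg_mul1r : right_id quotAlg_one quotAlg_mul.
Proof. by elim/quotAlgW=> x; rewrite quotAlg_mulE mulr1. Qed.
Fact quotAlg_mulDl : left_distributive quotAlg_mul +%R.
Proof.
elim/quotAlgW=> x; elim/quotAlgW=> y; elim/quotAlgW=> z.
by rewrite -raddfD !quotAlg_mulE mulrDl raddfD.
Qed.
Fact quotAlg_mulDr : right_distributive quotAlg_mul +%R.
Proof.
elim/quotAlgW=> x; elim/quotAlgW=> y; elim/quotAlgW=> z.
by rewrite -raddfD !quotAlg_mulE mulrDr raddfD.
Qed.

HB.instance Definition _ := GRing.Zmodule_isPzRing.Build quotAlg
  quotAlg_mulA quotAlg_mul1l quotAlg_mul1r quotAlg_mulDl quotAlg_mulDr.

Fact quotAlg_scalerA a b x :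
  quotAlg_scale a (quotAlg_scale b x) = quotAlg_scale (a * b) x.
Proof. by elim/quotAlgW: x => x; rewrite !quotAlg_scaleE scalerA. Qed.
Fact quotAlg_scale1r : left_id 1 quotAlg_scale.
Proof. by elim/quotAlgW=> x; rewrite quotAlg_scaleE scale1r. Qed.
Fact quotAlg_scalerDr : right_distributive quotAlg_scale +%R.
Proof.
move=> k; elim/quotAlgW=> x; elim/quotAlgW=> y.
by rewrite -raddfD !quotAlg_scaleE scalerDr raddfD.
Qed.
Fact quotAlg_scalerDl x : {morph quotAlg_scale^~ x : a b / a + b}.
Proof.
elim/quotAlgW: x => x a b /=.
by rewrite !quotAlg_scaleE scalerDl raddfD.
Qed.

HB.instance Definition _ := GRing.Zmodule_isLmodule.Build K quotAlg
  quotAlg_scalerA quotAlg_scale1r quotAlg_scalerDr quotAlg_scalerDl.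

Fact quotAlg_pi_monoid_morphism : monoid_morphism quotAlg_pi.
Proof. by split=> // x y; rewrite -quotAlg_mulE. Qed.

HB.instance Definition _ :=
  GRing.isMonoidMorphism.Build A quotAlg quotAlg_pi quotAlg_pi_monoid_morphism.

Fact quotAlg_pi_scalable : scalable quotAlg_pi.
Proof. by move=> k x; rewrite -quotAlg_scaleE. Qed.

HB.instance Definition _ :=
  GRing.isScalable.Build K A quotAlg *:%R quotAlg_pi quotAlg_pi_scalable.

Lemma quotAlg_scalerAl (k : K) (x y : quotAlg) : k *: (x * y) = k *: x * y.
Proof.
elim/quotAlgW: x => x; elim/quotAlgW: y => y.
by rewrite -rmorphM -!linearZ -rmorphM /= scalerAl.
Qed.

Lemma quotAlg_scalerAr (k : K) (x y : quotAlg) : k *: (x * y) = x * (k *: y).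
Proof.
elim/quotAlgW: x => x; elim/quotAlgW: y => y.
by rewrite -rmorphM -!linearZ -rmorphM /= scalerAr.
Qed.

End QuotientAlgebra.

Section FreeAlgebra.
Variables (K : comNzRingType) (X : choiceType).

Fact malg_scalerAr k (x y : {malg K[{fmonom X}]}) :
  k *: (x * y) = x * (k *: y).
Proof.
apply/malgP=> m.
rewrite mcoeffZ [X in k * X]mcoeffMl.
rewrite (@mcoeffMlw _ _ (msupp x) (msupp y)) ?msuppZ_le //.
rewrite mulr_sumr; apply: eq_bigr => i _.
rewrite mulr_sumr; apply: eq_bigr => j _.
by rewrite mcoeffZ mulrnAr mulrCA.
Qed.

Definition freeAlg : Type := {malg K[{fmonom X}]}.

HB.instance Definition _ := GRing.Lalgebra.on freeAlg.
HB.instance Definition _ := GRing.Lalgebra_isAlgebra.Build K freeAlg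
  malg_scalerAr.

Definition free_gen (i : X) : freeAlg := << fmu i >>.

(* constant coefficient, i.e. the morphism sending every generator to 0 *)
Definition free_eps : freeAlg -> K := @mcoeff {fmonom X} K mone.

HB.instance Definition _ :=
  GRing.RMorphism.copy free_eps (@mcoeff {fmonom X} K mone).

Lemma free_epsZ k x : free_eps (k *: x) = k * free_eps x.
Proof. exact: mcoeffZ. Qed.

Lemma free_eps_gen i : free_eps (free_gen i) = 0.
Proof. by rewrite /free_eps mcoeffU1 fmP fm1 /fmu fmE. Qed.

End FreeAlgebra.

Fact malg_word1 (K : comNzRingType) (X : choiceType) (s : seq X) :
  << FMonom s >> = \prod_(i <- s) << fmu i >> :> {malg K[{fmonom X}]}.
Proof.
elim: s => [|i s IHs]; first by rewrite big_nil -fmoneE.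
by rewrite big_cons -IHs malgM_def fgmulUU mulr1 /mmul /= fmmulE fmuE.
Qed.

Fact malg_word (K : comNzRingType) (X : choiceType) (k : K) (s : seq X) :
  << k *g FMonom s >> = k *: \prod_(i <- s) free_gen K i :> freeAlg K X.
Proof.
rewrite -[RHS]/(k *: \prod_(i <- s) << fmu i >> : {malg K[{fmonom X}]}).
rewrite -malg_word1; apply/malgP=> m'.
by rewrite mcoeffZ [LHS]mcoeffU mcoeffU1 mulr_natr.
Qed.

Section Lifting.
Variables (K : comNzRingType) (X : choiceType).

Section FreeLift.
Variables (A : algType K) (g : X -> A).

Definition word_prod (m : {fmonom X}) : A := \prod_(i <- m) g i.

Fact word_prod_mmorphism : mmorphism word_prod.
Proof.
split=> [m1 m2|]; rewrite /word_prod; last by rewrite fm1 big_nil.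
by rewrite fmM big_cat.
Qed.

HB.instance Definition _ :=
  isMultiplicative.Build {fmonom X} A word_prod word_prod_mmorphism.

Definition free_lift : freeAlg K X -> A := mmap (in_alg A) word_prod.

HB.instance Definition _ := GRing.Additive.on free_lift.

Fact free_lift_monoid_morphism : monoid_morphism free_lift.
Proof.
have [mM m1] : multiplicative free_lift; last by split.
apply: commr_mmap_is_multiplicative => x m m'.
by rewrite /GRing.comm /= mulr_algl mulr_algr.
Qed.

HB.instance Definition _ :=
  GRing.isMonoidMorphism.Build (freeAlg K X) A free_lift
    free_lift_monoid_morphism.

Lemma free_liftZ : scalable free_lift.
Proof. by move=> k x; rewrite /free_lift mmapZ /= mulr_algl. Qed.

HB.instance Definition _ :=
  GRing.isScalable.Build K (freeAlg K X) A *:%R free_lift free_liftZ.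

Lemma free_lift_gen i : free_lift (free_gen K i) = g i.
Proof.
rewrite /free_lift /free_gen mmapU /= /word_prod fmuE /=.
by rewrite big_seq1 scale1r mul1r.
Qed.

End FreeLift.
End Lifting.

Section QuotientLift.
Variables (K : comNzRingType) (A : algType K) (S : set A).
Variables (B : pzRingType) (f : {rmorphism A -> B}).

Definition quotAlg_lift (x : quotAlg S) : B := f (quotAlg_repr x).

Lemma quotAlg_liftE (fS : forall s, S s -> f s = 0) a :
  quotAlg_lift (quotAlg_pi S a) = f a.
Proof.
apply/eqP; rewrite -subr_eq0 -rmorphB; apply/eqP.
have /ideal_predP := quotAlg_pi_repr S a.
apply: (smallest_sub (X := [set x | f x = 0])) => [|y]; last exact: fS.
split=> [|y z /= y0 z0|b y /= y0|y b /= y0]; first exact: rmorph0.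
- by rewrite rmorphD y0 z0 addr0.
- by rewrite rmorphM y0 mulr0.
- by rewrite rmorphM y0 mul0r.
Qed.
End QuotientLift.

Lemma quotAlg_rel0 (K : comNzRingType) (A : algType K) (S : set A) x :
  S x -> quotAlg_pi S x = 0.
Proof.
move=> Sx; rewrite -(rmorph0 (quotAlg_pi S)).
apply/quotAlg_eqP/ideal_predP; rewrite subr0.
exact: sub_gen_smallest.
Qed.

Section RMorphismRelations.
Variables (A B : pzRingType) (f : {rmorphism A -> B}).

Lemma rmorph_adj x y : f (x * y * x - x) = f x * f y * f x - f x.
Proof. by rewrite rmorphB !rmorphM. Qed.

Lemma rmorph_far x y : f (x * y - y * x) = f x * f y - f y * f x.
Proof. by rewrite rmorphB !rmorphM. Qed.
End RMorphismRelations.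

(* 'I_n.-1 indexes the generators f_1, ..., f_(n-1): i stands for f_(i+1). *)
Section TemperleyLieb.
Variables (K : fieldType) (q : K) (n : nat).

Local Notation F := (@free_gen K 'I_n.-1).

Inductive TL_rel : set (freeAlg K 'I_n.-1) :=
| TL_rel_sqr i : TL_rel (F i ^+ 2 - (- (q + q^-1)) *: F i)
| TL_rel_adj (i j : 'I_n.-1) of (i.+1 == j) || (j.+1 == i) :
    TL_rel (F i * F j * F i - F i)
| TL_rel_far (i j : 'I_n.-1) of (i.+1 < j)%N || (j.+1 < i)%N :
    TL_rel (F i * F j - F j * F i).

Definition TL : Type := quotAlg TL_rel.

HB.instance Definition _ := GRing.PzRing.on TL.
HB.instance Definition _ := GRing.Lmodule.on TL.

Lemma TL_ideal_eps x : ideal_gen TL_rel x -> free_eps x = 0.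
Proof.
apply: (smallest_sub (X := [set x | free_eps x = 0])) => [|y].
  split=> [|y z /= y0 z0|a y /= y0|y a /= y0]; first exact: rmorph0.
  - by rewrite rmorphD /= y0 z0 addr0.
  - by rewrite rmorphM /= y0 mulr0.
  - by rewrite rmorphM /= y0 mul0r.
case=> [i|i j _|i j _] /=.
- by rewrite rmorphB /= free_epsZ expr2 rmorphM /= free_eps_gen !mulr0 subr0.
- by rewrite rmorph_adj /= !free_eps_gen !mulr0 subr0.
- by rewrite rmorph_far /= !free_eps_gen !mulr0 subr0.
Qed.

Fact TL_oner_neq0 : (1 : TL) != 0.
Proof.
apply/eqP=> eq10.
have /quotAlg_eqP : quotAlg_pi TL_rel 1 = quotAlg_pi TL_rel 0.
  by rewrite rmorph1 rmorph0.
rewrite subr0 => /ideal_predP/TL_ideal_eps; rewrite rmorph1.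
by apply/eqP; rewrite oner_neq0.
Qed.

HB.instance Definition _ := GRing.PzSemiRing_isNonZero.Build TL TL_oner_neq0.
HB.instance Definition _ :=
  GRing.Lmodule_isLalgebra.Build K TL (@quotAlg_scalerAl _ _ TL_rel).
HB.instance Definition _ :=
  GRing.Lalgebra_isAlgebra.Build K TL (@quotAlg_scalerAr _ _ TL_rel).

Definition TL_gen (i : 'I_n.-1) : TL := quotAlg_pi TL_rel (F i).

End TemperleyLieb.

Lemma leq_pred2 m n : (m <= n)%N -> (m.-1 <= n.-1)%N.
Proof. by case: m n => [|m] [|n]. Qed.

Section TLInclusion.
Variables (K : fieldType) (q : K) (m n : nat) (le_mn : (m <= n)%N).

Let incl (i : 'I_m.-1) : 'I_n.-1 := widen_ord (leq_pred2 le_mn) i.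

Definition TL_incl : TL q m -> TL q n :=
  quotAlg_lift (free_lift (fun i => TL_gen q (incl i))).

Lemma TL_sqr p (i : 'I_p.-1) :
  TL_gen q i ^+ 2 = - (q + q^-1) *: TL_gen q i.
Proof.
have := quotAlg_rel0 (TL_rel_sqr q i).
by rewrite rmorphB => /subr0_eq /=; rewrite quotAlg_pi_scalable expr2 rmorphM -expr2.
Qed.

Lemma TL_adj p (i j : 'I_p.-1) : (i.+1 == j) || (j.+1 == i) ->
  TL_gen q i * TL_gen q j * TL_gen q i = TL_gen q i.
Proof.
move=> ij; have := quotAlg_rel0 (TL_rel_adj q ij).
by rewrite rmorph_adj => /subr0_eq.
Qed.

Lemma TL_far p (i j : 'I_p.-1) : (i.+1 < j)%N || (j.+1 < i)%N ->
  TL_gen q i * TL_gen q j = TL_gen q j * TL_gen q i.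
Proof.
move=> ij; have := quotAlg_rel0 (TL_rel_far q ij).
by rewrite rmorph_far => /subr0_eq.
Qed.

Fact TL_incl_rel x : TL_rel q x ->
  free_lift (fun i => TL_gen q (incl i)) x = 0.
Proof.
case=> [i|i j ij|i j ij]; apply/eqP.
- rewrite rmorphB subr_eq0 /= free_liftZ expr2 rmorphM /= free_lift_gen -expr2.
  by apply/eqP; apply: TL_sqr.
- by rewrite rmorph_adj subr_eq0 /= !free_lift_gen; apply/eqP; apply: TL_adj.
- by rewrite rmorph_far subr_eq0 /= !free_lift_gen; apply/eqP; apply: TL_far.
Qed.

Lemma TL_incl_pi a : TL_incl (quotAlg_pi _ a) =
  free_lift (fun i => TL_gen q (incl i)) a.
Proof. by rewrite /TL_incl quotAlg_liftE //; apply: TL_incl_rel. Qed.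

Lemma TL_incl_gen i : TL_incl (TL_gen q i) = TL_gen q (incl i).
Proof. by rewrite TL_incl_pi free_lift_gen. Qed.

Fact TL_incl_zmod_morphism : zmod_morphism TL_incl.
Proof.
elim/quotAlgW=> x; elim/quotAlgW=> y.
by rewrite -rmorphB !TL_incl_pi rmorphB.
Qed.

HB.instance Definition _ :=
  GRing.isZmodMorphism.Build (TL q m) (TL q n) TL_incl TL_incl_zmod_morphism.

Fact TL_incl_monoid_morphism : monoid_morphism TL_incl.
Proof.
split=> [|]; first by rewrite TL_incl_pi rmorph1.
elim/quotAlgW=> x; elim/quotAlgW=> y.
by rewrite -rmorphM !TL_incl_pi rmorphM.
Qed.

HB.instance Definition _ :=
  GRing.isMonoidMorphism.Build (TL q m) (TL q n) TL_incl
    TL_incl_monoid_morphism.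

Fact TL_incl_scalable : scalable TL_incl.
Proof.
move=> k; elim/quotAlgW=> x.
by rewrite -linearZ !TL_incl_pi linearZ.
Qed.

HB.instance Definition _ :=
  GRing.isScalable.Build K (TL q m) (TL q n) *:%R TL_incl TL_incl_scalable.

End TLInclusion.

Section TLAugmentation.
Variables (K : fieldType) (q : K) (n : nat).

Definition TL_eps : TL q n -> K := quotAlg_lift (@free_eps K 'I_n.-1).

Lemma TL_eps_pi a : TL_eps (quotAlg_pi _ a) = free_eps a.
Proof.
rewrite /TL_eps quotAlg_liftE // => s rs; apply: (@TL_ideal_eps _ q).
exact: (@sub_gen_smallest _ _ (@TL_rel K q n)).
Qed.

Lemma TL_eps_gen i : TL_eps (TL_gen q i) = 0.
Proof. by rewrite TL_eps_pi free_eps_gen. Qed.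

Fact TL_eps_zmod_morphism : zmod_morphism TL_eps.
Proof.
elim/quotAlgW=> x; elim/quotAlgW=> y.
by rewrite -rmorphB !TL_eps_pi rmorphB.
Qed.

HB.instance Definition _ :=
  GRing.isZmodMorphism.Build (TL q n) K TL_eps TL_eps_zmod_morphism.

Fact TL_eps_monoid_morphism : monoid_morphism TL_eps.
Proof.
split=> [|]; first by rewrite TL_eps_pi rmorph1.
elim/quotAlgW=> x; elim/quotAlgW=> y.
by rewrite -rmorphM !TL_eps_pi rmorphM.
Qed.

HB.instance Definition _ :=
  GRing.isMonoidMorphism.Build (TL q n) K TL_eps TL_eps_monoid_morphism.
End TLAugmentation.

Section Clifford.
Variables (K : fieldType) (n : nat).

Local Notation X := (@free_gen K 'I_n).

Inductive Cl_rel : set (freeAlg K 'I_n) :=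
| Cl_rel_anticomm (i j : 'I_n) :
    Cl_rel (X i * X j + X j * X i - (i == j)%:R).

Definition Cl : Type := quotAlg Cl_rel.

HB.instance Definition _ := GRing.PzRing.on Cl.
HB.instance Definition _ := GRing.Lmodule.on Cl.

Definition Cl_gen (i : 'I_n) : Cl := quotAlg_pi Cl_rel (X i).

(* linear combination of words in the generators, given as pairs
   (coefficient, word) *)
Definition Cl_comb (l : seq (K * seq 'I_n)) : Cl :=
  \sum_(t <- l) t.1 *: \prod_(i <- t.2) Cl_gen i.

Definition even_pred : {pred Cl} :=
  [pred x | `[< exists2 l, all (fun t => ~~ odd (size t.2)) l
                         & x = Cl_comb l >]].

Fact even_subring_closed : subring_closed even_pred.
Proof.
split.
- apply/asboolP; exists [:: (1, [::])] => //.
  by rewrite /Cl_comb big_seq1 big_nil scale1r.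
- move=> x y /asboolP[l el ->] /asboolP[r er ->]; apply/asboolP.
  exists (l ++ [seq (- t.1, t.2) | t <- r]).
    by rewrite all_cat el all_map.
  rewrite /Cl_comb big_cat big_map -sumrN; congr (_ + _).
  by apply: eq_bigr => t _; rewrite scaleNr.
- move=> x y /asboolP[l el ->] /asboolP[r er ->]; apply/asboolP.
  exists [seq (t.1 * u.1, t.2 ++ u.2) | t <- l, u <- r].
    apply/allP=> _ /allpairsP[[t u] [/= tl ur ->]] /=.
    rewrite size_cat oddD (negbTE (allP el _ tl)).
    by rewrite (negbTE (allP er _ ur)).
  rewrite /Cl_comb big_allpairs_dep /= mulr_suml; apply: eq_bigr => t _.
  rewrite mulr_sumr; apply: eq_bigr => u _.
  by rewrite -quotAlg_scalerAl -quotAlg_scalerAr scalerA big_cat.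
Qed.

HB.instance Definition _ :=
  GRing.isSubringClosed.Build Cl even_pred even_subring_closed.

Fact even_scaler_closed : GRing.scaler_closed even_pred.
Proof.
move=> k x /asboolP[l el ->]; apply/asboolP.
exists [seq (k * t.1, t.2) | t <- l]; first by rewrite all_map.
rewrite /Cl_comb big_map scaler_sumr; apply: eq_bigr => t _.
by rewrite scalerA.
Qed.

HB.instance Definition _ :=
  GRing.isScaleClosed.Build K Cl even_pred even_scaler_closed.

Record Cl0 : predArgType := MkCl0 { Cl0_val : Cl; _ : Cl0_val \in even_pred }.

HB.instance Definition _ := [isSub for Cl0_val].
HB.instance Definition _ := [Choice of Cl0 by <:].
HB.instance Definition _ :=
  GRing.SubChoice_isSubPzRing.Build Cl even_pred Cl0 even_subring_closed.
HB.instance Definition _ := [SubZmodule_isSubLmodule of Cl0 by <:].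

End Clifford.

Section TrigPi4.
Variable R : realType.

Lemma cos_pi4_gt0 : 0 < cos (pi / 4 : R).
Proof.
by have p0 := pi_gt0 R; apply: cos_gt0_pihalf; apply/andP; split; lra.
Qed.

Lemma pi2_pi4 : pi / 2 = pi / 4 + pi / 4 :> R.
Proof. by field. Qed.

Lemma cos_sin_pi4 : cos (pi / 4 : R) = sin (pi / 4).
Proof.
have := cos_pihalf R; rewrite pi2_pi4 cosD => h.
have := sin_pihalf R; rewrite pi2_pi4 sinD => h'.
have c0 := cos_pi4_gt0.
move: (cos _) (sin _) c0 h h' => c s c0 h h'; nra.
Qed.

Lemma sqr_cos_pi4 : 2 * cos (pi / 4 : R) ^+ 2 = 1.
Proof.
have := cos2Dsin2 (pi / 4 : R); rewrite -cos_sin_pi4 => h; lra.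
Qed.

Lemma two_cos_pi4 : 2 * cos (pi / 4 : R) = Num.sqrt 2.
Proof.
have c0 := cos_pi4_gt0; have c2 := sqr_cos_pi4.
rewrite -[LHS]ger0_norm; last lra.
rewrite -sqrtr_sqr; congr Num.sqrt; rewrite exprMn.
move: c2; rewrite !expr2; lra.
Qed.
End TrigPi4.

Section JonesWenzlIdentities.
Variables (K : comNzRingType) (A : algType K) (s : K) (x y : A).
Hypothesis ss : s * s = 2.
Hypothesis xx : x ^+ 2 = s *: x.
Hypothesis xyx : x * y * x = x.

Lemma jw3_mull : x * (1 + x * y + y * x - s *: (x + y)) = 0.
Proof.
rewrite mulrBr !mulrDr mulr1 !mulrA xyx -expr2 xx -scalerAl -scalerAr.
rewrite mulrDr -expr2 xx scalerDr scalerA ss scaler_nat mulr2n.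
by rewrite [x + _ + x]addrAC subrr.
Qed.

Lemma jw3_mulr : (1 + x * y + y * x - s *: (x + y)) * x = 0.
Proof.
rewrite mulrBl !mulrDl mul1r xyx -[y * x * x]mulrA -expr2 xx.
rewrite -scalerAr -scalerAl mulrDl -expr2 xx.
by rewrite scalerDr scalerA ss scaler_nat mulr2n subrr.
Qed.

Lemma jw3C :
  1 + x * y + y * x - s *: (x + y) = 1 + y * x + x * y - s *: (y + x).
Proof. by rewrite (addrAC 1) [x + y]addrC. Qed.

Lemma jw3_absorb z : x * z = 0 -> y * z = 0 ->
  (1 + x * y + y * x - s *: (x + y)) * z = z.
Proof.
move=> xz yz; rewrite mulrBl -scalerAl !mulrDl -!mulrA xz yz !mulr0.
by rewrite mul1r !addr0 scaler0 subr0.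
Qed.
End JonesWenzlIdentities.

Lemma idempotent_multiple (K : fieldType) (A : algType K) (E F : A) (c : K) :
  E != 0 -> F != 0 -> E * E = E -> F * E = E -> E = c *: F -> E = F.
Proof.
move=> E0 F0 EE FE defE.
have cE : c *: E = E by rewrite -[RHS]EE {2}defE -scalerAl FE.
have /eqP : (c * c - c) *: F = 0 by rewrite scalerBl -scalerA -defE cE subrr.
rewrite scaler_eq0 (negbTE F0) orbF -{3}[c]mulr1 -mulrBr mulf_eq0.
case/orP=> [/eqP c0|]; first by rewrite defE c0 scale0r eqxx in E0.
by rewrite subr_eq0 => /eqP c1; rewrite defE c1 scale1r.
Qed.

Lemma ord2P (i : 'I_2) : i = ord0 \/ i = ord_max.
Proof. by case: i => [[|[|k]] ik] //; [left | right]; apply: val_inj. Qed.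

Lemma rmorph_jw3 (K : comNzRingType) (A : algType K) (B : pzRingType)
    (f : {rmorphism A -> B}) s x y : f x = 0 -> f y = 0 -> 
    f (1 + x * y + y * x - s *: (x + y)) = 1.
Proof.
move=> fx fy; rewrite -mulr_algl rmorphB !rmorphD !rmorphM rmorphD rmorph1.
by rewrite fx fy !mulr0 !addr0 mulr0 subr0.
Qed.

Section AtEighthRoot.
Variable R : realType.
Local Open Scope complex_scope.

Definition cexp (z : R[i]) : R[i] :=
  (expR (complex.Re z))%:C * (cos (complex.Im z) +i* sin (complex.Im z)).

Definition q : R[i] := - cexp (pi%:C * 'i / 4).

Lemma qE : q = - ((cos (pi / 4)) +i* (cos (pi / 4))).
Proof.
rewrite /q; suff -> : pi%:C * 'i / 4 = 0 +i* (pi / 4) :> R[i].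
  by rewrite /cexp /= expR0 mul1r -cos_sin_pi4.
have n4 : (4 : R[i]) != 0 by rewrite pnatr_eq0.
apply: (mulIf n4); rewrite mulfVK //.
have -> : (4 : R[i]) = (4 : R)%:C by rewrite rmorph_nat.
apply/eqP; rewrite eq_complex /=.
by apply/andP; split; apply/eqP; field.
Qed.

Lemma q_sqr : q ^+ 2 = 'i.
Proof.
have c2 := sqr_cos_pi4 R.
rewrite qE sqrrN expr2; apply/eqP; rewrite eq_complex /=.
move: c2; rewrite expr2 => c2.
by apply/andP; split; apply/eqP; lra.
Qed.

Lemma q_delta : - (q + q^-1) = (Num.sqrt 2)%:C.
Proof.
have c2 := sqr_cos_pi4 R.
have -> : q^-1 = - ((cos (pi / 4)) +i* (- cos (pi / 4))).
  have q0 : q != 0.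
    apply/eqP=> q0; have := q_sqr; rewrite q0 expr0n /= => /eqP.
    by rewrite eq_complex /= => /andP[_]; rewrite eq_sym oner_eq0.
  apply: (mulfI q0); rewrite divff // qE mulrNN.
  apply/eqP; rewrite eq_complex /=.
  by move: c2; rewrite expr2 => c2; apply/andP; split; apply/eqP; lra.
rewrite qE -opprD opprK -two_cos_pi4; apply/eqP; rewrite eq_complex /=.
by apply/andP; split; apply/eqP; lra.
Qed.

Definition E3 : TL q 3 :=
  let f1 := TL_gen q (n := 3) ord0 in
  let f2 := TL_gen q (n := 3) ord_max in
  1 + f1 * f2 + f2 * f1 - (Num.sqrt 2)%:C *: (f1 + f2).

Definition jones_wenzl (E : TL q 3) : Prop :=
  [/\ E != 0, E * E = E &
      forall i, TL_gen q i * E = 0 /\ E * TL_gen q i = 0].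

Let f1 : TL q 3 := TL_gen q (n := 3) ord0.
Let f2 : TL q 3 := TL_gen q (n := 3) ord_max.

Lemma E3_annihilated i : TL_gen q i * E3 = 0 /\ E3 * TL_gen q i = 0.
Proof.
have ss : (Num.sqrt 2)%:C * (Num.sqrt 2)%:C = 2 :> R[i].
  by rewrite -rmorphM -expr2 sqr_sqrtr // rmorph_nat.
have f11 j : TL_gen q (n := 3) j ^+ 2 = (Num.sqrt 2)%:C *: TL_gen q j.
  by rewrite TL_sqr q_delta.
have f121 : f1 * f2 * f1 = f1 by apply: TL_adj.
have f212 : f2 * f1 * f2 = f2 by apply: TL_adj.
have E3C : E3 = 1 + f2 * f1 + f1 * f2 - (Num.sqrt 2)%:C *: (f2 + f1).
  exact: jw3C.
have [-> | ->] := ord2P i.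
  by split; [exact: (jw3_mull ss (f11 ord0) f121)
           | exact: (jw3_mulr ss (f11 ord0) f121)].
by rewrite E3C; split; [exact: (jw3_mull ss (f11 ord_max) f212)
                      | exact: (jw3_mulr ss (f11 ord_max) f212)].
Qed.

Lemma E3_neq0 : E3 != 0.
Proof.
have eE : TL_eps E3 = 1 by apply: rmorph_jw3; apply: TL_eps_gen.
by apply: contra_eq_neq eE => ->; rewrite rmorph0 eq_sym oner_neq0.
Qed.

Lemma TL_absorb n (x : TL q n) : exists c, forall E : TL q n,
  ((forall i, TL_gen q i * E = 0) -> x * E = c *: E) /\
  ((forall i, E * TL_gen q i = 0) -> E * x = c *: E).
Proof.
elim/quotAlgW: x => a; rewrite [a]monalgE rmorph_sum /=.
apply: (big_ind (fun x : TL q n => exists c, forall E : TL q n,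
  ((forall i, TL_gen q i * E = 0) -> x * E = c *: E) /\
  ((forall i, E * TL_gen q i = 0) -> E * x = c *: E))).
- by exists 0 => E; split=> _; rewrite ?mul0r ?mulr0 scale0r.
- move=> x y [c cE] [d dE]; exists (c + d) => E.
  have [xl xr] := cE E; have [yl yr] := dE E; split=> fE.
    by rewrite mulrDl xl // yl // scalerDl.
  by rewrite mulrDr xr // yr // scalerDl.
- move=> m _; move: (mcoeff m a) => k; case: m => s.
rewrite malg_word quotAlg_pi_scalable rmorph_prod /= -/(TL_gen q _).
case: s => [|i s].
  by exists k => E; rewrite big_nil -scalerAl -scalerAr mul1r mulr1.
exists 0 => E; rewrite scale0r -scalerAl -scalerAr; split=> fE.
  rewrite lastI -cats1 big_cat big_seq1 /= -mulrA fE.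
  by rewrite mulr0 scaler0.
by rewrite big_cons mulrA fE mul0r scaler0.
Qed.

Lemma E3_jones_wenzl E : jones_wenzl E <-> E = E3.
Proof.
have E3E x : (forall i, TL_gen q i * x = 0) -> E3 * x = x.
  by move=> fx; apply: jw3_absorb; apply: fx.
split=> [[E0 EE fE]|->]; last first.
  split; [exact: E3_neq0| |exact: E3_annihilated].
  by apply: E3E => i; have [] := E3_annihilated i.
have [c /(_ E3)[_ cr]] := TL_absorb E.
have E3EE : E3 * E = E by apply: E3E => i; have [] := fE i.
apply: (idempotent_multiple E0 E3_neq0 EE E3EE (c := c)).
by rewrite -E3EE; apply: cr => i; have [] := E3_annihilated i.
Qed.

(* The quotient of TL_n(q) by the ideal generated by the image of E3. *)
Definition Q4 (n : nat) (hn : (3 <= n)%N) : Type :=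
  quotAlg [set TL_incl hn E3].

HB.instance Definition _ n hn := GRing.PzRing.on (@Q4 n hn).
HB.instance Definition _ n hn := GRing.Lmodule.on (@Q4 n hn).

End AtEighthRoot.

(* Main.v *)
Require Import Defs.
From HB Require Import structures.
From mathcomp Require Import all_boot all_order all_algebra.
From mathcomp Require Import complex reals.
From mathcomp Require Import ring zify.
From mathcomp.multinomials Require Import monalg.
From mathcomp Require Import boolp classical_sets functions.

Set Implicit Arguments.
Unset Strict Implicit.
Unset Printing Implicit Defensive.

Import GRing.Theory Num.Theory.
Local Open Scope ring_scope.
Local Open Scope complex_scope.

(** Put s = sqrt 2 and u_i = s f_i - 1. The relation f_i^2 = s f_i says that
    u_i is an involution, f_i f_j f_i = f_i says that
    (1 + u_i) u_j (1 + u_i) = 0, and the Jones-Wenzl idempotent is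
    E_3 = (u_1 u_2 + u_2 u_1) / 2. So in the quotient u_1 and u_2 anticommute;
    conjugating (1 + u_2) u_3 (1 + u_2) = 0 by u_1, which commutes with u_3,
    shows that u_2 and u_3 anticommute as well, and so on
    ([anticomm_propagates]). Hence the quotient is the algebra presented by a
    chain of involutions u_1, ..., u_(n-1) in which neighbours anticommute and
    all other pairs commute ([spin_ising], [Q4_universal]).

    In the Clifford algebra the elements 2i c_k c_(k+1) form such a chain
    ([bond_ising]), whence a morphism from the quotient to the Clifford
    algebra. Its image is the even part, because the bonds generate it
    ([even_ind]).

    For injectivity no basis or dimension is computed. The even part is a
    module over the whole Clifford algebra, with even elements acting by left
    multiplication and c_1 acting by a multiple of x |-> c_1 x c_1. The same
    action can be written down on the quotient itself, where conjugation by
    c_1 becomes the automorphism that changes the sign of u_1: this uses that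
    the Clifford generators can be recovered from c_1 and the bonds
    ([Cl_from_ising]). Then x in the quotient, sent to the Clifford algebra and
    back to an endomorphism of the quotient, acts as left multiplication by x,
    and x is found again by acting on 1 ([chain_to_Cl_inj]). *)

(** * The algebra of endomorphisms of a module *)

Section EndomorphismAlgebra.
Variables (K : comNzRingType) (V : lmodType K).

Definition linear_pred : {pred V -> V} := [pred f | `[< linear f >]].

Fact linear_pred_submod_closed : submod_closed linear_pred.
Proof.
split=> [|k f g /asboolP lf /asboolP lg]; apply/asboolP=> a x y.
  by rewrite /= scaler0 addr0.
have kfgE z : (k *: f + g) z = k *: f z + g z by [].
by rewrite !kfgE lf lg !scalerDr !scalerA [k * a]mulrC addrACA.
Qed.

HB.instance Definition _ :=
  GRing.isSubmodClosed.Build K (V -> V) linear_pred linear_pred_submod_closed.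

(** The proof that V is non-zero is an index of the type because an algebra
    structure requires 1 != 0. *)
Record endo (V_neq0 : exists v : V, v != 0) : predArgType :=
  Endo { endo_fun :> V -> V; _ : endo_fun \in linear_pred }.

Variable V_neq0 : exists v : V, v != 0.
Local Notation E := (endo V_neq0).

HB.instance Definition _ := [isSub for @endo_fun V_neq0].
HB.instance Definition _ := [Choice of E by <:].
HB.instance Definition _ := [SubChoice_isSubLmodule of E by <:].

Lemma endoP (f g : E) : f =1 g -> f = g.
Proof. by move=> fg; apply/val_inj/funext. Qed.

Lemma endo_linear (f : E) : linear f.
Proof. by case: f => f /= /asboolP. Qed.

Lemma endoD (f g : E) x : (f + g) x = f x + g x. Proof. by []. Qed.
Lemma endoZ k (f : E) x : (k *: f) x = k *: f x. Proof. by []. Qed.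

Definition endo_of f (lf : linear f) : E := @Endo V_neq0 f (asboolT lf).

Definition endo_one : E := @endo_of idfun (fun _ _ _ => erefl).

Fact endo_mul_linear (f g : E) : linear (f \o g).
Proof. by move=> a x y; rewrite /= !endo_linear. Qed.
Definition endo_mul f g : E := endo_of (endo_mul_linear f g).

Fact endo_mulDl : left_distributive endo_mul +%R.
Proof. by move=> f g h; apply: endoP. Qed.

Fact endo_mulDr : right_distributive endo_mul +%R.
Proof.
move=> f g h; apply: endoP => x.
rewrite -[LHS]/(f (g x + h x)) -[RHS]/(f (g x) + f (h x)).
by rewrite -[g x]scale1r endo_linear !scale1r.
Qed.

Fact endo_one_neq0 : endo_one != 0.
Proof.
have [v /eqP v0] := V_neq0; apply/eqP=> e; apply: v0.
by rewrite -[LHS]/(endo_one v) e.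
Qed.

Fact endo_mulA : associative endo_mul. Proof. by move=> f g h; apply: endoP. Qed.
Fact endo_mul1f : left_id endo_one endo_mul. Proof. by move=> f; apply: endoP. Qed.
Fact endo_mulf1 : right_id endo_one endo_mul. Proof. by move=> f; apply: endoP. Qed.

HB.instance Definition _ := GRing.Zmodule_isNzRing.Build E
  endo_mulA endo_mul1f endo_mulf1 endo_mulDl endo_mulDr endo_one_neq0.

Fact endo_scalerAl (k : K) (f g : E) : k *: (f * g) = k *: f * g.
Proof. exact: endoP. Qed.

HB.instance Definition _ := GRing.Lmodule_isLalgebra.Build K E endo_scalerAl.

Fact endo_scalerAr (k : K) (f g : E) : k *: (f * g) = f * (k *: g).
Proof.
apply: endoP => x; rewrite -[LHS]/(k *: f (g x)) -[RHS]/(f (k *: g x)).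
have f0 : f 0 = 0 by move: (endo_linear f (-1) 0 0); rewrite !scaleN1r !addNr.
by rewrite -[k *: g x]addr0 endo_linear f0 addr0.
Qed.

HB.instance Definition _ := GRing.Lalgebra_isAlgebra.Build K E endo_scalerAr.

Lemma endoM (f g : E) x : (f * g) x = f (g x). Proof. by []. Qed.
Lemma endo_sign (b : bool) (f : E) x : ((-1) ^+ b * f) x = (if b then - f x else f x).
Proof. by case: b; rewrite ?expr1 ?expr0 ?mulN1r ?mul1r. Qed.
Lemma endo1 x : (1 : E) x = x. Proof. by []. Qed.

End EndomorphismAlgebra.

(** * Morphisms out of quotients and free algebras *)

Section QuotientMorphisms.
Variable K : comNzRingType.

Lemma quotAlg_factor (A : algType K) (S : set A) (B : pzRingType)
    (f : {rmorphism A -> B}) : (forall x, S x -> f x = 0) ->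
  exists g : {rmorphism quotAlg S -> B}, forall a, g (quotAlg_pi S a) = f a.
Proof.
move=> fS; have gE := quotAlg_liftE fS.
have gB : zmod_morphism (quotAlg_lift (S := S) f).
  elim/quotAlgW=> x; elim/quotAlgW=> y.
  by rewrite -rmorphB !gE rmorphB.
have gM : monoid_morphism (quotAlg_lift (S := S) f).
  split; first by rewrite -(rmorph1 (quotAlg_pi S)) gE rmorph1.
  elim/quotAlgW=> x; elim/quotAlgW=> y.
  by rewrite -rmorphM !gE rmorphM.
pose g : {rmorphism quotAlg S -> B} := HB.pack (quotAlg_lift (S := S) f)
  (GRing.isZmodMorphism.Build _ _ _ gB) (GRing.isMonoidMorphism.Build _ _ _ gM).
by exists g.
Qed.

(** The target need not be a non-trivial ring, so the free algebra is first
    mapped to A, at representatives of the prescribed images. *)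
Lemma free_to_quotAlg (X : choiceType) (A : algType K) (S : set A)
    (b : X -> quotAlg S) :
  exists g : {rmorphism freeAlg K X -> quotAlg S},
    scalable g /\ forall i, g (free_gen K i) = b i.
Proof.
exists (quotAlg_pi S \o free_lift (fun i => quotAlg_repr (b i))).
split=> [k x|i] /=; first by rewrite free_liftZ quotAlg_pi_scalable.
by rewrite free_lift_gen quotAlg_reprK.
Qed.

Lemma free_ind (X : choiceType) (P : freeAlg K X -> Prop) :
    P 1 -> (forall x y, P x -> P y -> P (x + y)) ->
    (forall k x, P x -> P (k *: x)) ->
    (forall i x, P x -> P (free_gen K i * x)) ->
  forall x, P x.
Proof.
move=> P1 PD PZ PM x; rewrite [x]monalgE.
apply: (big_ind P) => [||m _]; last 1 first.
- move: (mcoeff m x) => k; case: m => w; rewrite malg_word; apply: PZ.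
  by elim: w => [|i w IHw]; rewrite ?big_nil // big_cons; apply: PM.
- by rewrite -(scale0r 1); apply: PZ.
- exact: PD.
Qed.

(** An induction principle, which also says that the words in the v i span. *)
Definition generated_by (X : Type) (A : algType K) (S : set A)
    (v : X -> quotAlg S) : Prop :=
  forall P : quotAlg S -> Prop,
    P 1 -> (forall x y, P x -> P y -> P (x + y)) ->
    (forall k x, P x -> P (k *: x)) ->
    (forall i x, P x -> P (v i * x)) ->
  forall x, P x.

Lemma rmorph_jones_wenzl (A A' : algType K) (S : set A')
    (f : {rmorphism A -> quotAlg S}) (k : K) x y : scalable f ->
  f (1 + x * y + y * x - k *: (x + y)) =
  1 + f x * f y + f y * f x - k *: (f x + f y).
Proof.
by move=> fZ; rewrite rmorphB !rmorphD !rmorphM rmorph1 fZ rmorphD.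
Qed.

Lemma rmorph_anticomm (A B : pzRingType) (f : {rmorphism A -> B}) x y n :
  f (x * y + y * x - n%:R) = f x * f y + f y * f x - n%:R.
Proof. by rewrite rmorphB rmorphD !rmorphM rmorph_nat. Qed.

End QuotientMorphisms.

(** * Elements that commute up to a sign *)

Section SignedCommutation.
Variable B : pzRingType.
Implicit Types (x y z : B) (b c : bool).

(** With the sign kept as a boolean, the rule for a product is an exclusive or,
    and all commutations between words reduce to boolean identities. *)
Definition scomm b x y : Prop := x * y = (-1) ^+ b * (y * x).

Lemma scomm_sym b x y : scomm b x y -> scomm b y x.
Proof. by rewrite /scomm => ->; rewrite signrMK. Qed.

Lemma scommMr b c x y z : scomm b x y -> scomm c x z -> scomm (b (+) c) x (y * z).
Proof.
rewrite /scomm => xy xz; rewrite mulrA xy -!mulrA xz.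
by case: b c {xy xz} => [] []; rewrite ?expr0 ?expr1 ?mulN1r ?mul1r ?mulrN ?opprK !mulrA.
Qed.

Lemma scommMl b c x y z : scomm b x z -> scomm c y z -> scomm (b (+) c) (x * y) z.
Proof. by move=> xz yz; apply/scomm_sym/scommMr; apply: scomm_sym. Qed.

Lemma scommT x y : scomm true x y -> x * y = - (y * x).
Proof. by rewrite /scomm expr1 mulN1r. Qed.

Definition adjacent (i j : nat) : bool := (i.+1 == j) || (j.+1 == i).

(** The terms of the Hamiltonian of the quantum Ising chain satisfy these
    relations; hence the name. *)
Definition ising_family m (u : 'I_m -> B) : Prop :=
  (forall i, u i * u i = 1) /\ (forall i j : 'I_m, scomm (adjacent i j) (u i) (u j)).

(** Source of the sign-changing automorphism of the quotient algebra. *)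
Lemma ising_sign m (u : 'I_m -> B) (b : 'I_m -> bool) :
  ising_family u -> ising_family (fun i => (-1) ^+ b i * u i).
Proof.
move=> [uu uC]; split=> [i | i j].
  by case: (b i); rewrite ?expr0 ?expr1 ?mulN1r ?mul1r ?mulrNN uu.
have := uC i j; rewrite /scomm.
by case: (b i) (b j) => [] [];
  rewrite ?expr0 ?expr1 ?mulN1r ?mul1r ?mulrNN ?mulNr ?mulrN => ->.
Qed.

End SignedCommutation.

Section ScaledCommutation.
Variable K : comNzRingType.

Lemma scommZr (A : algType K) k b (x y : A) : scomm b x y -> scomm b x (k *: y).
Proof. by rewrite /scomm -scalerAr -scalerAl => ->; rewrite scalerAr. Qed.

Lemma quotAlg_scommZr (A : algType K) (S : set A) k b (x y : quotAlg S) :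
  scomm b x y -> scomm b x (k *: y).
Proof.
rewrite /scomm -quotAlg_scalerAr -quotAlg_scalerAl => ->.
exact: quotAlg_scalerAr.
Qed.
End ScaledCommutation.

(** * The Temperley-Lieb relations for the involutions u = s f - 1 *)

Section TLInvolutions.
Variables (K : fieldType) (A : algType K) (S : set A).
Local Notation B := (quotAlg S).
Variable s : K.
Hypotheses (ss : s * s = 2) (s0 : s != 0).
Implicit Types (k : K) (u v w x y : B).

Let ZMl k x y : k *: x * y = k *: (x * y).
Proof. by rewrite quotAlg_scalerAl. Qed.

Let ZMr k x y : x * (k *: y) = k *: (x * y).
Proof. by rewrite quotAlg_scalerAr. Qed.

Let two_neq0 : (2 : K) != 0.
Proof. by rewrite -ss mulf_neq0. Qed.

Lemma scaler_double x : x + x = 2 *: x.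
Proof. by rewrite scaler_nat mulr2n. Qed.

Lemma involution_sqr u x : s *: x = 1 + u -> u * u = 1 -> x ^+ 2 = s *: x.
Proof.
move=> xu uu; have s20 : s * s != 0 by rewrite mulf_neq0.
apply: (scalerI s20); rewrite -scalerA -[s *: x ^+ 2]ZMl -ZMr xu ss.
by rewrite mulrDl mul1r mulrDr mulr1 uu [u + 1]addrC scaler_double.
Qed.

Lemma sqr_involution u x : s *: x = 1 + u -> x ^+ 2 = s *: x -> u * u = 1.
Proof.
move=> xu xx; have -> : u = s *: x - 1 by rewrite xu addrC addKr.
rewrite mulrBr mulr1 mulrBl mul1r ZMl ZMr -expr2 xx !scalerA ss -scalerA.
by rewrite -scaler_double addrK opprB addrC subrK.
Qed.

(** Moving v to the left turns the first factor into 1 - u, and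
    (1 - u) (1 + u) = 0. *)
Lemma anticomm_sandwich u v : u * u = 1 -> scomm true u v ->
  (1 + u) * v * (1 + u) = 0.
Proof.
move=> uu /scommT uv; rewrite mulrDl mul1r uv -[v - _](_ : v * (1 - u) = _).
  by rewrite -mulrA mulrBl mul1r [u * _]mulrDr mulr1 uu [u + 1]addrC subrr mulr0.
by rewrite mulrBr mulr1.
Qed.

Lemma involution_adj u v x y : s *: x = 1 + u -> s *: y = 1 + v ->
  u * u = 1 -> (1 + u) * v * (1 + u) = 0 -> x * y * x = x.
Proof.
move=> xu yv uu uvu; have s30 : s * s * s != 0 by rewrite !mulf_neq0.
apply: (scalerI s30).
have -> : s * s * s *: (x * y * x) = (s *: x) * (s *: y) * (s *: x).
  by rewrite !(ZMl, ZMr) !scalerA.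
rewrite -!scalerA !xu yv [(1 + u) * (1 + v)]mulrDr mulr1 mulrDl uvu addr0.
by rewrite mulrDl mul1r mulrDr mulr1 uu [u + 1]addrC scaler_double scalerA ss.
Qed.

Lemma adj_sandwich u v x y : s *: x = 1 + u -> s *: y = 1 + v ->
  x ^+ 2 = s *: x -> x * y * x = x -> (1 + u) * v * (1 + u) = 0.
Proof.
move=> xu yv xx xyx; have -> : v = s *: y - 1 by rewrite yv addrC addKr.
rewrite -xu mulrBr mulrBl mulr1 !(ZMl, ZMr) xyx -expr2 xx.
by rewrite subrr.
Qed.

(** Makes commutators and anticommutators of u, v expressible in x, y. *)
Lemma involution_mul u v x y : s *: x = 1 + u -> s *: y = 1 + v ->
  u * v = 2 *: (x * y) + (1 - s *: (x + y)).
Proof.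
move=> xu yv; have -> : u = s *: x - 1 by rewrite xu addrC addKr.
have -> : v = s *: y - 1 by rewrite yv addrC addKr.
rewrite mulrBr mulr1 mulrBl mul1r !(ZMl, ZMr) scalerA ss scalerDr.
by rewrite opprB -addrA; congr (_ + _); rewrite addrCA -opprD [s *: y + _]addrC.
Qed.

Lemma involution_far u v x y : s *: x = 1 + u -> s *: y = 1 + v ->
  u * v = v * u <-> x * y = y * x.
Proof.
move=> xu yv; rewrite (involution_mul xu yv) (involution_mul yv xu) [y + x]addrC.
split=> [/addIr/(scalerI two_neq0) // | -> //].
Qed.

(** The Jones-Wenzl element is half the anticommutator of u and v. *)
Lemma jones_wenzl_anticomm u v x y : s *: x = 1 + u -> s *: y = 1 + v ->
  scomm true u v <-> 1 + x * y + y * x - s *: (x + y) = 0.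
Proof.
move=> xu yv.
have E : u * v + v * u = 2 *: (1 + x * y + y * x - s *: (x + y)).
  rewrite (involution_mul xu yv) (involution_mul yv xu) [y + x]addrC.
  rewrite addrACA scaler_double -!scalerDr addrA [_ + 1]addrC.
  by rewrite [1 + (_ + _)]addrA.
split=> [/scommT uv | E0].
  by apply: (scalerI two_neq0); rewrite scaler0 -E uv addNr.
by rewrite /scomm expr1 mulN1r; apply/eqP; rewrite -addr_eq0 E E0 scaler0.
Qed.

(** The sandwich is the sum of w + v w v and v w + w v. Conjugation by u fixes
    the first and negates the second, so both vanish. *)
Lemma anticomm_propagates u v w : u * u = 1 -> scomm true u v ->
  scomm false u w -> (1 + v) * w * (1 + v) = 0 -> scomm true v w.
Proof.
move=> uu /scommT uv; rewrite /scomm expr0 mul1r => uw vwv.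
have conj : u * (1 + v) = (1 - v) * u.
  by rewrite mulrDr mulrBl mulr1 mul1r uv.
have vwv' : (1 - v) * w * (1 - v) = 0.
  have : u * ((1 + v) * w * (1 + v)) * u = 0 by rewrite vwv mulr0 mul0r.
  rewrite !mulrA conj -[(1 - v) * u * w]mulrA uw mulrA -[_ * u * (1 + v)]mulrA.
  by rewrite conj !mulrA -[_ * u * u]mulrA uu mulr1.
have expand z : (1 + z) * w * (1 + z) = (w + z * w * z) + (z * w + w * z).
  by rewrite mulrDl mul1r mulrDr mulr1 mulrDl [w * z + _]addrC addrACA.
move: vwv vwv'; rewrite !expand mulNr mulrNN mulrN -opprD => vwv /subr0_eq vwvE.
rewrite /scomm expr1 mulN1r; apply/eqP; rewrite -addr_eq0; apply/eqP.
by apply: (scalerI two_neq0); rewrite scaler0 -scaler_double -{1}vwvE.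
Qed.
End TLInvolutions.

(** * The chain of bonds in the Clifford algebra *)

Section CliffordRelations.
Variables (K : fieldType) (m : nat).
Local Notation C := (Cl K m.+1).
Local Notation c := (@Cl_gen K m.+1).
Implicit Types (k l : 'I_m.+1) (i j : 'I_m).

Lemma Cl_anticomm k l : c k * c l + c l * c k = (k == l)%:R.
Proof.
have := quotAlg_rel0 (Cl_rel_anticomm K k l).
by rewrite rmorph_anticomm => /subr0_eq.
Qed.

Lemma Cl_scomm k l : scomm (k != l) (c k) (c l).
Proof.
case: eqVneq => [-> | kl]; first by rewrite /scomm expr0 mul1r.
have := Cl_anticomm k l; rewrite (negbTE kl) => /eqP.
by rewrite addr_eq0 /scomm expr1 mulN1r => /eqP.
Qed.

Definition bond_src i : 'I_m.+1 := widen_ord (leqnSn m) i.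
Definition bond_tgt i : 'I_m.+1 := lift ord0 i.

Variable I : K.

(** The factor 2 I compensates c_k ^ 2 = 1/2 and the sign of
    (c_k c_(k+1)) ^ 2, so that bonds are involutions. *)
Definition bond i : C := (2 * I) *: (c (bond_src i) * c (bond_tgt i)).

Lemma bond_scomm k i : scomm ((k == i :> nat) || (k == i.+1 :> nat)) (c k) (bond i).
Proof.
apply: quotAlg_scommZr.
have := scommMr (Cl_scomm k (bond_src i)) (Cl_scomm k (bond_tgt i)).
rewrite (_ : _ (+) _ = (k == i :> nat) || (k == i.+1 :> nat)) //.
by rewrite -!(inj_eq val_inj) /= /bump add1n; lia.
Qed.

Hypothesis two_neq0 : (2 : K) != 0.
Hypothesis II : I * I = -1.

Lemma Cl_sqr k : c k * c k = 2^-1 *: (1 : C) :> C.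
Proof.
apply: (scalerI two_neq0); rewrite scalerA divff // scale1r -scaler_double.
by rewrite Cl_anticomm eqxx.
Qed.

Lemma bond_ising : ising_family bond.
Proof.
split=> [i | i j].
  have := Cl_scomm (bond_tgt i) (bond_src i).
  rewrite (_ : bond_tgt i != bond_src i = true); last first.
    by rewrite -(inj_eq val_inj) /= /bump add1n; lia.
  rewrite /bond; have := Cl_sqr (bond_src i); have := Cl_sqr (bond_tgt i).
  move: (c (bond_src i)) (c (bond_tgt i)) => x y yy xx /scommT yx.
  rewrite -quotAlg_scalerAl -quotAlg_scalerAr scalerA [x * y * _]mulrA -[x * y * x]mulrA yx.
  rewrite mulrN mulNr mulrA xx -mulrA yy -quotAlg_scalerAl mul1r scalerN -scaleNr.
  rewrite !scalerA.
  have -> : - (2 * I * (2 * I)) * 2^-1 * 2^-1 = - (I * I) by field.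
  by rewrite II opprK scale1r.
apply/scomm_sym/quotAlg_scommZr/scomm_sym.
have := scommMl (bond_scomm (bond_src i) j) (bond_scomm (bond_tgt i) j).
rewrite (_ : _ (+) _ = adjacent i j) //.
by rewrite /= /bump add1n /adjacent; lia.
Qed.

End CliffordRelations.

Section EvenPart.
Variables (K : fieldType) (m : nat).
Local Notation C := (Cl K m.+1).
Local Notation c := (@Cl_gen K m.+1).
Variable I : K.
Hypotheses (two_neq0 : (2 : K) != 0) (II : I * I = -1).

Lemma bond_even i : bond I i \in @even_pred K m.+1.
Proof.
apply/asboolP; exists [:: (2 * I, [:: bond_src i; bond_tgt i])] => //.
by rewrite /Cl_comb big_seq1 /= big_cons big_seq1.
Qed.

(** The bonds generate the even part: c_k c_l = 2 (c_k c_0) (c_0 c_l), and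
    c_0 c_(k+1) is a multiple of c_0 c_k times the bond k. *)
Lemma even_ind (P : C -> Prop) :
    P 1 -> (forall x y, P x -> P y -> P (x + y)) ->
    (forall k x, P x -> P (k *: x)) -> (forall x y, P x -> P y -> P (x * y)) ->
    (forall i, P (bond I i)) ->
  forall y, y \in @even_pred K m.+1 -> P y.
Proof.
move=> P1 PD PZ PM Pbond.
(* A generator can be inserted in the middle, as c_k c_k = 1/2. *)
have insert k x y : P (x * c k) -> P (c k * y) -> P (x * y).
  move: (c k) (Cl_sqr two_neq0 k) => z zz Pxz Pzy; have := PZ 2 _ (PM _ _ Pxz Pzy).
  rewrite mulrA -[x * z * z]mulrA zz -quotAlg_scalerAr mulr1.
  by rewrite -quotAlg_scalerAl scalerA divff // scale1r.
have Pnext i : P (c (bond_src i) * c (bond_tgt i)).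
  have := PZ (2^-1 * - I) _ (Pbond i); rewrite scalerA.
  have -> : 2^-1 * - I * (2 * I) = - (I * I) by field.
  by rewrite II opprK scale1r.
have P0k k : P (c ord0 * c k).
  case: k => k; elim: k => [|k IHk] km.
    rewrite (_ : Ordinal km = ord0); last exact: val_inj.
    by rewrite Cl_sqr //; apply: PZ.
  apply: (insert (Ordinal (ltnW km))) => //.
  have := Pnext (Ordinal (km : (k < m)%N)).
  rewrite (_ : bond_src _ = Ordinal (ltnW km)); last exact: val_inj.
  by rewrite (_ : bond_tgt _ = Ordinal km); last exact: val_inj.
have Pk0 k : P (c k * c ord0).
  have := Cl_scomm K k ord0; case: eqVneq => [-> _ | _ /scommT ->]; first exact: P0k.
  by rewrite -scaleN1r; apply: PZ.
have Pkl k l : P (c k * c l) := insert _ _ _ (Pk0 k) (P0k l).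
have Pword n w : size w = n.*2 -> P (\prod_(k <- w) c k).
  elim: n w => [|n IHn] [|k [|l w]] //=; first by rewrite big_nil.
  by case=> /IHn Pw; rewrite !big_cons mulrA; apply: PM.
move=> _ /asboolP[t te ->]; rewrite /Cl_comb big_seq.
apply: (big_ind P) => [||[k w] /(allP te) /= we].
- by have := PZ 0 _ P1; rewrite scale0r.
- exact: PD.
- by apply: PZ; apply: (Pword (size w)./2); rewrite even_halfK.
Qed.
End EvenPart.

(** * Clifford generators from a chain *)

Section CliffordFromIsing.
Variables (K : fieldType) (m : nat) (A : algType K).
Variables (I : K) (g0 : A) (u : 'I_m -> A).
Hypotheses (two_neq0 : (2 : K) != 0) (II : I * I = -1).
Hypothesis g0_sqr : g0 * g0 = 2^-1 *: 1.
Hypothesis g0_u : forall i : 'I_m, scomm (i == 0 :> nat) g0 (u i).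
Hypothesis u_ising : ising_family u.

(** In the Clifford algebra bond k = 2 I c_k c_(k+1), so
    c_(k+1) = - I c_k bond k. This recursion starts from g0 in the place of
    c_0. *)
Fixpoint clifford_chain (k : nat) : A :=
  if k is k'.+1 then - I *: (clifford_chain k' * oapp u 1 (insub k')) else g0.
Local Notation g := clifford_chain.

Lemma clifford_chainS (i : 'I_m) : g i.+1 = - I *: (g i * u i).
Proof. by rewrite /= valK. Qed.

Lemma clifford_chain_scomm k (i : 'I_m) : (k <= m)%N ->
  scomm ((k == i) || (k == i.+1)) (g k) (u i).
Proof.
elim: k => [|k IHk] km; first by have := g0_u i; rewrite eq_sym orbF.
rewrite (clifford_chainS (Ordinal km)); apply/scomm_sym/scommZr/scomm_sym.
have /= := scommMl (IHk (ltnW km)) (u_ising.2 (Ordinal km) i).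
rewrite (_ : _ (+) _ = (k.+1 == i) || (k.+1 == i.+1)) //.
by rewrite /adjacent /=; lia.
Qed.

Lemma clifford_chain_sqr k : (k <= m)%N -> g k * g k = 2^-1 *: 1.
Proof.
elim: k => [|k IHk] km; first exact: g0_sqr.
rewrite (clifford_chainS (Ordinal km)) /= -scalerAl -scalerAr scalerA mulrNN II.
set v := u _; have := clifford_chain_scomm (Ordinal km) (ltnW km).
rewrite /= eqxx => /scommT gv.
rewrite {1}gv mulNr mulrA -[v * _ * _]mulrA IHk 1?ltnW //.
by rewrite -scalerAr mulr1 -scalerAl u_ising.1 scaleN1r opprK.
Qed.

Lemma clifford_chain_anticomm k l : (k < l <= m)%N -> scomm true (g k) (g l).
Proof.
elim: l => [|l IHl] // /andP[kl lm].
rewrite (clifford_chainS (Ordinal lm)) /=; apply: scommZr.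
have gk : scomm (k != l) (g k) (g l).
  case: eqVneq => [-> | klN]; first by rewrite /scomm expr0 mul1r.
  by apply: IHl; lia.
have /= := scommMr gk (clifford_chain_scomm (Ordinal lm) (ltnW (leq_trans kl lm))).
by rewrite (_ : _ (+) _ = true) //=; lia.
Qed.

(** An element g0 that behaves like c_0 towards the bonds is all that a chain
    lacks to define a representation of the Clifford algebra. *)
Lemma Cl_from_ising : exists rho : {rmorphism Cl K m.+1 -> A},
  scalable rho /\ forall i, rho (bond I i) = u i.
Proof.
pose f := free_lift (fun k : 'I_m.+1 => g k).
have [x []| rho rhoE] := quotAlg_factor (S := @Cl_rel K m.+1) (f := f).
  move=> k l; rewrite rmorph_anticomm /= !free_lift_gen; apply/eqP; rewrite subr_eq0; apply/eqP.
  have [-> | kl] := eqVneq k l.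
    rewrite clifford_chain_sqr -1?ltnS // -mulr2n -scaler_nat scalerA divff //.
    by rewrite scale1r.
  wlog : k l kl / (k < l)%N => [hwlog | klt].
    have : k != l :> nat by [].
    by rewrite neq_ltn => /orP[/hwlog-> // | /hwlog]; rewrite addrC eq_sym; apply.
  apply/eqP; rewrite addr_eq0; apply/eqP/scommT/clifford_chain_anticomm.
  by rewrite klt -ltnS /=.
have rhoZ : scalable rho.
  by move=> a; elim/quotAlgW=> x; rewrite -quotAlg_pi_scalable !rhoE; apply: free_liftZ.
have rhoG k : rho (Cl_gen K k) = g k := etrans (rhoE _) (free_lift_gen _ _).
exists rho; split=> // i.
rewrite /bond rhoZ rmorphM !rhoG.
have -> : bond_tgt i = i.+1 :> nat by rewrite /= /bump add1n.
rewrite clifford_chainS /= -scalerAr scalerA mulrA clifford_chain_sqr 1?ltnW //.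
rewrite -scalerAl mul1r scalerA.
have -> : 2 * I * - I * 2^-1 = - (I * I) by field.
by rewrite II opprK scale1r.
Qed.
End CliffordFromIsing.

(** * Injectivity on an algebra generated by a chain *)

Section ChainAlgebra.
Variables (K : fieldType) (m : nat) (A : algType K) (S : set A).
Local Notation Q := (quotAlg S).
Variable v : 'I_m -> Q.

Hypotheses (v_ising : ising_family v) (v_gen : generated_by v).
Variables (sigma : {rmorphism Q -> Q}) (s I : K).
Hypothesis sigmaZ : scalable sigma.
Hypothesis sigmaE : forall i, sigma (v i) = (-1) ^+ (i == 0 :> nat) * v i.
Hypotheses (ss : s * s = 2) (s0 : s != 0) (II : I * I = -1).

Lemma flip_involutive : involutive sigma.
Proof.
apply: v_gen => [|x y xE yE|k x xE|i x xE].
- by rewrite !rmorph1.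
- by rewrite !rmorphD xE yE.
- by rewrite !sigmaZ xE.
- by rewrite !rmorphM xE sigmaE rmorphM rmorph_sign sigmaE signrMK.
Qed.

Lemma flip_linear : linear sigma.
Proof. by move=> k x y; rewrite rmorphD sigmaZ. Qed.

Lemma mul_linear (z : Q) : linear ( *%R z).
Proof. by move=> k x y; rewrite mulrDr quotAlg_scalerAr. Qed.

(** The Clifford algebra acts on Q, with c_0 acting by the flip divided by
    sqrt 2 and bond i by left multiplication by v i. Through phi an element x
    then acts by left multiplication, so x is recovered from phi x. *)
Lemma chain_to_Cl_inj (phi : {rmorphism Q -> Cl K m.+1}) :
  scalable phi -> (forall i, phi (v i) = bond I i) -> injective phi.
Proof.
move=> phiZ phiE.
(* Over the zero ring the endomorphisms form no algebra in the above sense. *)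
have [nz | z] := pselect (exists x : Q, x != 0); last first.
  have z0 (x : Q) : x = 0 by apply/eqP/negPn/negP => x0; apply: z; exists x.
  by move=> x y _; rewrite (z0 x) (z0 y).
pose g0 : endo nz := s^-1 *: endo_of nz flip_linear.
pose L i : endo nz := endo_of nz (mul_linear (v i)).
have two_neq0 : (2 : K) != 0 by rewrite -ss mulf_neq0.
have [|i||rho [rhoZ rhoE]] := @Cl_from_ising K m (endo nz) I g0 L two_neq0 II.
- apply: endoP => x; rewrite /g0 -scalerAl -scalerAr scalerA !endoZ endoM endo1.
  by rewrite -invfM ss [endo_fun _ _]flip_involutive.
- rewrite /g0; apply: scomm_sym; apply: scommZr; apply: scomm_sym; apply: endoP => x.
  have : sigma (v i * x) = (-1) ^+ (i == 0 :> nat) * (v i * sigma x).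
    by rewrite rmorphM sigmaE mulrA.
  by rewrite endo_sign mulr_sign; case: eqP.
- split=> [i | i j]; apply: endoP => x.
    by rewrite -[LHS]/(v i * (v i * x)) mulrA v_ising.1 mul1r.
  have : v i * (v j * x) = (-1) ^+ adjacent i j * (v j * (v i * x)).
    by rewrite mulrA (v_ising.2 i j) !mulrA.
  by rewrite endo_sign mulr_sign; case: adjacent.
have rho_phi x : forall y, rho (phi x) y = x * y.
  elim/v_gen: x => [|x x' xE xE'|k x xE|i x xE] y.
  - by rewrite !rmorph1 mul1r.
  - by rewrite !rmorphD endoD xE xE' mulrDl.
  - by rewrite phiZ rhoZ endoZ xE quotAlg_scalerAl.
  - by rewrite !rmorphM endoM xE phiE rhoE -mulrA.
by move=> x x' xx'; rewrite -[x]mulr1 -rho_phi xx' rho_phi mulr1.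
Qed.

End ChainAlgebra.

(** * The quotient of the Temperley-Lieb algebra *)

Section Quotient.
Variables (R : realType) (n : nat) (hn : (3 <= n)%N).
Local Notation K := (R[i]).
Local Notation TLn := (TL (q R) n).
Local Notation S := [set TL_incl hn (E3 R)]%classic.
Local Notation Q := (quotAlg S).
Local Notation pi := (quotAlg_pi S).
Implicit Types (i j : 'I_n.-1).

Definition sqrt2 : K := (Num.sqrt 2)%:C.
Local Notation s := sqrt2.

Lemma sqrt2M : s * s = 2.
Proof. by rewrite -rmorphM -expr2 sqr_sqrtr // rmorph_nat. Qed.

Lemma sqrt2_neq0 : s != 0.
Proof.
have := pnatr_eq0 K 2; rewrite -sqrt2M.
by apply: contraFneq => ->; rewrite mulr0.
Qed.

Definition spin i : Q := s *: pi (TL_gen (q R) i) - 1.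

Lemma spinE i : s *: pi (TL_gen (q R) i) = 1 + spin i.
Proof. by rewrite addrC subrK. Qed.

Lemma TL_incl_jones_wenzl i j : i = 0 :> nat -> j = 1 :> nat ->
  TL_incl hn (E3 R) =
  1 + TL_gen (q R) i * TL_gen (q R) j + TL_gen (q R) j * TL_gen (q R) i
  - s *: (TL_gen (q R) i + TL_gen (q R) j).
Proof.
move=> i0 j1; have inclZ := @TL_incl_scalable _ (q R) _ _ hn.
rewrite [LHS](rmorph_jones_wenzl (f := TL_incl hn) _ _ _ inclZ) /= !TL_incl_gen.
rewrite (_ : widen_ord _ ord0 = i); last by apply: val_inj; rewrite /= i0.
by rewrite (_ : widen_ord _ ord_max = j); last by apply: val_inj; rewrite /= j1.
Qed.

(** Only the first two spins anticommute by definition of the ideal; the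
    property then passes from each pair of neighbours to the next. *)
Lemma spin_ising : ising_family spin.
Proof.
have s0 := sqrt2_neq0; have ss := sqrt2M.
have piM x y : pi (x * y) = pi x * pi y := rmorphM pi x y.
have genX i : pi (TL_gen (q R) i) ^+ 2 = s *: pi (TL_gen (q R) i).
  by rewrite -rmorphXn /= TL_sqr q_delta quotAlg_pi_scalable.
have genA i j : adjacent i j ->
    pi (TL_gen (q R) i) * pi (TL_gen (q R) j) * pi (TL_gen (q R) i) =
    pi (TL_gen (q R) i).
  by move=> ij; rewrite -!piM TL_adj.
have far i j : (i.+1 < j)%N || (j.+1 < i)%N -> scomm false (spin i) (spin j).
  move=> ij; rewrite /scomm expr0 mul1r.
  apply/(involution_far ss s0 (spinE i) (spinE j)).
  by rewrite -!piM TL_far.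
have next k i j : i = k :> nat -> j = k.+1 :> nat -> scomm true (spin i) (spin j).
  elim: k i j => [|k IHk] i j ik jk.
    apply/(jones_wenzl_anticomm ss s0 (spinE i) (spinE j)).
    rewrite -(rmorph_jones_wenzl (f := pi)); last exact: quotAlg_pi_scalable.
    by rewrite -(TL_incl_jones_wenzl ik jk); apply: quotAlg_rel0.
  have hk : (k < n.-1)%N by rewrite (leq_trans _ (ltn_ord i)) // ik.
  apply: (anticomm_propagates ss s0 (u := spin (Ordinal hk))).
  - exact: (sqr_involution ss (spinE _) (genX _)).
  - exact: IHk.
  - by apply: far; rewrite /= jk ltnSn.
  - apply: (adj_sandwich (spinE i) (spinE j) (genX i) (genA i j _)).
    by rewrite /adjacent ik jk eqxx.
split=> [i | i j]; first exact: (sqr_involution ss (spinE i) (genX i)).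
have [<- | ij] := eqVneq i j; first by rewrite /adjacent (gtn_eqF (ltnSn i)) /scomm expr0 mul1r.
rewrite /adjacent; case: eqP => [ij1 | nij] /=; first exact: (next i).
case: eqP => [ji1 | nji]; first exact/scomm_sym/(next j).
by apply: far; move: ij; rewrite -(inj_eq val_inj) /=; lia.
Qed.

Lemma spin_generated : generated_by spin.
Proof.
move=> P P1 PD PZ PM.
pose h : {rmorphism freeAlg K 'I_n.-1 -> Q} := pi \o quotAlg_pi (@TL_rel K (q R) n).
have hZ : scalable h by move=> k x; rewrite /= !quotAlg_pi_scalable.
suff Ph x : P (h x) by elim/quotAlgW; elim/quotAlgW.
elim/free_ind: x => [|x y Px Py|k x Px|i x].
- by rewrite rmorph1.
- by rewrite rmorphD; apply: PD.
- by rewrite hZ; apply: PZ.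
rewrite rmorphM; move: (h x) => y Py.
(* The generator f_i is (1 + u_i) / s. *)
have := PZ s^-1 _ (PD _ _ Py (PM i _ Py)).
rewrite -{1}[y]mul1r -mulrDl -spinE.
by rewrite -quotAlg_scalerAl scalerA mulVf ?sqrt2_neq0 // scale1r.
Qed.

(** Together with [spin_ising]: the quotient is presented by the spins and the
    chain relations. *)
Lemma Q4_universal (A : algType K) (S' : set A) (U : 'I_n.-1 -> quotAlg S') :
  ising_family U ->
  exists g : {rmorphism Q -> quotAlg S'},
    scalable g /\ forall i, g (spin i) = U i.
Proof.
have s0 := sqrt2_neq0; have ss := sqrt2M.
move=> [UU UC]; pose x i := s^-1 *: (1 + U i).
have xE i : s *: x i = 1 + U i by rewrite scalerA divff // scale1r.
have [f0 [f0Z f0E]] := free_to_quotAlg x.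
have [r []|f1 f1E] := quotAlg_factor (S := @TL_rel K (q R) n) (f := f0).
- move=> i; rewrite rmorphB f0Z rmorphXn /= !f0E q_delta.
  by rewrite (involution_sqr ss s0 (xE i) (UU i)) subrr.
- move=> i j ij; rewrite rmorph_adj !f0E.
  have := anticomm_sandwich (UU i) (v := U j); have := UC i j.
  rewrite /adjacent ij => uv /(_ uv) uvu.
  by rewrite (involution_adj ss s0 (xE i) (xE j) (UU i) uvu) subrr.
- move=> i j ij; rewrite rmorph_far !f0E; apply/eqP; rewrite subr_eq0; apply/eqP.
  apply/(involution_far ss s0 (xE i) (xE j)).
  have := UC i j; rewrite (_ : adjacent i j = false); last by rewrite /adjacent; lia.
  by rewrite /scomm expr0 mul1r.
have f1Z : scalable f1.
  by move=> a; elim/quotAlgW=> y; rewrite -quotAlg_pi_scalable !f1E f0Z.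
have f1G i : f1 (TL_gen (q R) i) = x i by rewrite f1E f0E.
have [r -> |f2 f2E] := quotAlg_factor (S := S) (f := f1).
  have h0 : (0 < n.-1)%N by lia.
  have h1 : (1 < n.-1)%N by lia.
  rewrite (@TL_incl_jones_wenzl (Ordinal h0) (Ordinal h1)) //.
  rewrite rmorph_jones_wenzl // !f1G.
  apply/(jones_wenzl_anticomm ss s0 (xE _) (xE _)).
  exact: (UC (Ordinal h0) (Ordinal h1)).
have f2Z : scalable f2.
  by move=> a; elim/quotAlgW=> y; rewrite -quotAlg_pi_scalable !f2E f1Z.
exists f2; split=> // i.
by rewrite /spin rmorphB f2Z f2E f1G xE rmorph1 addrC addKr.
Qed.

End Quotient.

(** * The isomorphism *)

Lemma primitive_root4 (F : fieldType) (z : F) :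
  (2 : F) != 0 -> z ^+ 2 = -1 -> 4.-primitive_root z.
Proof.
move=> two_neq0 zz.
have N1 : (-1 == 1 :> F) = false.
  by rewrite -subr_eq0 -opprD oppr_eq0 (negbTE two_neq0).
apply/andP; split=> //; apply/forallP => -[k k4]; rewrite unity_rootE /=.
case: k k4 => [|[|[|[|k]]]] // _.
- rewrite expr1 eqbF_neg; apply/eqP => z1.
  by move: N1; rewrite -zz z1 expr1n eqxx.
- by rewrite zz N1.
- rewrite exprS zz mulrN1 eqbF_neg; apply/eqP => /(congr1 -%R); rewrite opprK => z1.
  by move: N1; rewrite -zz z1 sqrrN expr1n eqxx.
- by rewrite (exprM z 2 2 : z ^+ 4 = _) zz sqrrN expr1n !eqxx.
Qed.

Lemma inj_surj_bijective (T U : Type) (f : T -> U) :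
  injective f -> (forall y, exists x, f x = y) -> bijective f.
Proof.
move=> finj /choice[g gK]; exists g => // x; exact/finj/gK.
Qed.

Lemma Q4_to_Cl0 (R : realType) (m : nat) (hn : (3 <= m.+1)%N) :
  exists phibar : {rmorphism Q4 R hn -> Cl0 R[i] m.+1},
    scalable phibar /\ bijective phibar.
Proof.
have II : 'i * 'i = -1 :> R[i] by rewrite -expr2 sqr_i.
have two_neq0 : (2 : R[i]) != 0 by rewrite pnatr_eq0.
have [f [fZ fE]] := Q4_universal hn (bond_ising m two_neq0 II).
have [sigma [sigmaZ sigmaE]] :=
  Q4_universal hn (ising_sign (fun i => i == 0 :> nat) (spin_ising R hn)).
have finj := chain_to_Cl_inj (spin_ising R hn) (@spin_generated R _ hn) sigmaZ sigmaE
  (sqrt2M R) (sqrt2_neq0 R) II fZ fE.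
have feven x : f x \in @even_pred R[i] m.+1.
  elim/(@spin_generated R _ hn): x => [|x y xe ye|k x xe|i x xe].
  - by rewrite rmorph1 rpred1.
  - by rewrite rmorphD rpredD.
  - by rewrite fZ; apply: even_scaler_closed.
  - by rewrite rmorphM rpredM // fE bond_even.
pose g (x : Q4 R hn) : Cl0 R[i] m.+1 := MkCl0 (feven x).
have gB : zmod_morphism g by move=> x y; apply: val_inj; rewrite /= rmorphB.
have gM : monoid_morphism g.
  by split=> [|x y]; apply: val_inj; rewrite /= ?rmorph1 ?rmorphM.
pose phibar : {rmorphism Q4 R hn -> Cl0 R[i] m.+1} := HB.pack g
  (GRing.isZmodMorphism.Build _ _ _ gB) (GRing.isMonoidMorphism.Build _ _ _ gM).
exists phibar; split; first by move=> k x; apply: val_inj; rewrite /= fZ.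
apply: inj_surj_bijective => [x y /(congr1 val) /finj // | [y ye]].
have [x fx] : exists x, f x = y; last by exists x; apply: val_inj.
apply: (even_ind two_neq0 II (P := fun y => exists x, f x = y)) ye
  => [|_ _ [x <-] [z <-]|k _ [x <-]|_ _ [x <-] [z <-]|i].
- by exists 1; rewrite rmorph1.
- by exists (x + z); rewrite rmorphD.
- by exists (k *: x); rewrite fZ.
- by exists (x * z); rewrite rmorphM.
- by exists (spin R hn i).
Qed.

Theorem theorem5p4 (R : realType) :
  [/\ q R ^+ 2 = 'i,
      4.-primitive_root (q R ^+ 2) &
      forall (n : nat) (hn : (3 <= n)%N),
        exists phi : {rmorphism TL (q R) n -> Cl0 R[i] n},
          [/\ scalable phi,
              forall y, exists x, phi x = y &
              exists phibar : {rmorphism Q4 R hn -> Cl0 R[i] n},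
                [/\ scalable phibar,
                    forall x, phibar (quotAlg_pi _ x) = phi x &
                    bijective phibar]]].
Proof.
split; first exact: q_sqr.
  by apply: primitive_root4; rewrite ?q_sqr ?sqr_i ?pnatr_eq0.
case=> [|m] hn //; have [phibar [phibarZ phibar_bij]] := Q4_to_Cl0 R hn.
pose pi : {rmorphism TL (q R) m.+1 -> Q4 R hn} :=
  quotAlg_pi [set TL_incl hn (E3 R)]%classic.
have [psi _ psiK] := phibar_bij.
exists (phibar \o pi); split=> [k x | y |].
- by rewrite /= quotAlg_pi_scalable phibarZ.
- by exists (quotAlg_repr (psi y)); rewrite /= quotAlg_reprK psiK.
- by exists phibar.
Qed.
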